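(* Let $\ell \in \mathbb{N}_0$, and let $f_{\ell}(x) = \sum_{n=0}^{\infty} a_{n,\ell}\, x^n$ and $g_{\ell}(x) = \sum_{n=0}^{\infty} b_{n,\ell}\, x^n$. Suppose that $[n]_{\ell} +_{(\ell)} [k]_{\ell} = [n+k]_{\ell}$ for all $n,k \in \mathbb{N}_0$. Then $$ {}_{\ell}D_M^{(x)}\left[ f_{\ell}(x)\, g_{\ell}(x) \right] = g_{\ell}(x)\; {}_{\ell}D_M^{(x)}\left[ f_{\ell}(x) \right] \; +_{(\ell)} \; f_{\ell}(x)\; {}_{\ell}D_M^{(x)}\left[ g_{\ell}(x) \right].$$
   Context: $\mathbb{N}_0$ is the set of non-negative integers. **$\ell$-number.** For $n \in \mathbb{N}$, $[n]_{\ell} = n^{\ell n+1}\,((n-1)!)^{\ell} = \dfrac{(n!)^{\ell n+1}}{((n-1)!)^{\ell n-\ell+1}}$, and $[0]_{\ell} = 0$. **Operator.** Let $\theta = z\frac{d}{dz}$. For $p\in\mathbb{N}_0$, $\alpha\in\mathbb{C}$ and $f(z)=\sum_{n\ge 1} a_n z^n$, put ${}_p\Delta_{\alpha}^{\theta}(f(z)) = \sum_{n\ge1} a_n\, (\alpha)_{n-1}^p\, (\theta+\alpha-1)^{pn}(z^n)$ if $p\ge 1$, and ${}_0\Delta_{\alpha}^{\theta}(f)=f$. Here $(\alpha)_m=\alpha(\alpha+1)\cdots(\alpha+m-1)$ is the Pochhammer symbol and $(\theta+\alpha)^r$ means $r$-fold composition. For $f(z)=\sum_{n\ge0}a_nz^n$,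 define ${}_pD_M^{(z)}[f(z)] = z^{-1}\,{}_p\Delta_1^{\theta}(\theta f(z))$. Explicitly, ${}_{\ell}D_M^{(x)}\left[\sum_{n\ge0} a_n x^n\right] = \sum_{n\ge 1} [n]_{\ell}\, a_n x^{n-1}$. Power series are manipulated termwise. **The operation $+_{(\ell)}$.** $+_{(\ell)}$ is a binary operation on $\ell$-numbers, assumed to satisfy the hypothesis in the statement. Between the two series on the right-hand side it acts term by term on their double-series expansions. Write $$g_\ell\,{}_{\ell}D_M^{(x)}[f_\ell]=\sum_{n\ge1}\sum_{k\ge0}[n]_\ell\, a_{n,\ell}b_{k,\ell}\,x^{n+k-1}, \qquad f_\ell\,{}_{\ell}D_M^{(x)}[g_\ell]=\sum_{n\ge0}\sum_{k\ge1}[k]_\ell\, a_{n,\ell}b_{k,\ell}\,x^{n+k-1}.$$ Then $$g_\ell\,{}_{\ell}D_M^{(x)}[f_\ell] +_{(\ell)} f_\ell\,{}_{\ell}D_M^{(x)}[g_\ell] := \sum_{n,k\ge0,\ n+k\ge1} \left([n]_\ell +_{(\ell)} [k]_\ell\right) a_{n,\ell}b_{k,\ell}\,x^{n+k-1}.$$ *)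

(* Defs.v *)
From HB Require Import structures.
From mathcomp Require Import all_boot all_order all_algebra.
From mathcomp Require Import reals.
From mathcomp Require Export complex.
Set Implicit Arguments.
Unset Strict Implicit.
Unset Printing Implicit Defensive.
Import GRing.Theory.
Local Open Scope ring_scope.

Definition lnum (l n : nat) : nat :=
  if n is n'.+1 then (n ^ (l * n).+1 * n'`! ^ l)%N else 0%N.

(* [f m] is the coefficient of z^m; equality of series is [=1]. *)
Definition fps (K : Type) : Type := nat -> K.

Section FormalPowerSeries.
Variable K : comNzRingType.
Implicit Types (f g : fps K) (a : K).

Definition fps_mul f g : fps K := fun m => \sum_(i < m.+1) f i * g (m - i)%N.

Definition fps_monomial (n : nat) : fps K := fun m => (m == n)%:R.

Definition fps_scale a f : fps K := fun m => a * f m.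

Definition fps_mulX f : fps K := fun m => if m is m'.+1 then f m' else 0.

(* Only meaningful when the constant term [f 0] vanishes. *)
Definition fps_divX f : fps K := fun m => f m.+1.

Definition fps_deriv f : fps K := fun m => f m.+1 *+ m.+1.

(* Sum of the [u n] over n >= 1, for families in which [u n] is divisible by
   z^n: the terms with n > m do not contribute to the coefficient of z^m. *)
Definition fps_sum (u : nat -> fps K) : fps K :=
  fun m => \sum_(1 <= n < m.+1) u n m.

Definition theta f : fps K := fps_mulX (fps_deriv f).

Definition theta_shift a f : fps K := fun m => theta f m + a * f m.

Definition pochhammer a (m : nat) : K := \prod_(i < m) (a + i%:R).

Definition Delta (p : nat) a f : fps K :=
  if p is 0 then f else
  fps_sum (fun n => fps_scale (f n * pochhammer a n.-1 ^+ p)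
                      (iter (p * n) (theta_shift (a - 1)) (fps_monomial n))).

Definition DM (p : nat) f : fps K := fps_divX (Delta p 1 (theta f)).

(* The double series
     \sum_(n, k >= 0, n + k >= 1) w n k * f n * g k * x^(n + k - 1);
   the coefficient of x^m collects the pairs with n + k = m + 1. *)
Definition double_series (w : nat -> nat -> nat) f g : fps K :=
  fun m => \sum_(n < m.+2) (w n (m.+1 - n)%N)%:R * f n * g (m.+1 - n)%N.

End FormalPowerSeries.

Definition weight_gDf (l : nat) : nat -> nat -> nat := fun n k => lnum l n.
Definition weight_fDg (l : nat) : nat -> nat -> nat := fun n k => lnum l k.

(* A series [s] has many expansions of this form, so a term-by-term operation
   on the weights takes the chosen expansions, not just their sums, as
   arguments. *)
Record expansion (K : comNzRingType) (f g s : fps K) := Expansion {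
  weight : nat -> nat -> nat;
  expansionP : s =1 double_series weight f g }.

(* [op] is the operation on l-numbers; its values at other natural numbers
   are irrelevant when all the weights of [E1] and [E2] are l-numbers. *)
Definition termwise (op : nat -> nat -> nat) (K : comNzRingType)
    (f g s1 s2 : fps K) (E1 : expansion f g s1) (E2 : expansion f g s2) :
    fps K :=
  double_series (fun n k => op (weight E1 n k) (weight E2 n k)) f g.
Arguments termwise op {K f g} s1 s2 E1 E2.

Section Expansions.
Variable K : comNzRingType.
Implicit Types f g : fps K.

Lemma thetaE f m : theta f m = f m *+ m.
Proof. by case: m. Qed.

Lemma iter_theta_monomial r n m :
  iter r (theta_shift (1 - 1 : K)) (fps_monomial K n) m
  = (n ^ r)%:R * fps_monomial K n m.
Proof.
elim: r m => [|r IH] m; first by rewrite expn0 mul1r.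
rewrite iterS; move: IH; set h := iter r _ _ => IH.
rewrite /theta_shift (thetaE h m) IH subrr mul0r addr0 /fps_monomial.
case: (m =P n) => [->|_]; last by rewrite !mulr0 mul0rn.
by rewrite !mulr1 expnS mulnC natrM mulr_natr.
Qed.

Lemma pochhammer1 m : pochhammer (1 : K) m = (m`!)%:R.
Proof.
rewrite /pochhammer; elim: m => [|m IH]; first by rewrite big_ord0.
by rewrite big_ord_recr /= IH factS natrM mulrC -natr1 [1 + _]addrC.
Qed.

Lemma DME l f m : DM l f m = (lnum l m.+1)%:R * f m.+1.
Proof.
rewrite /DM /fps_divX /lnum; case: l => [|l].
  by rewrite [Delta _ _ _]/= thetaE mul0n expn1 expn0 muln1 mulr_natl.
rewrite /Delta /fps_sum big_nat_recr // big_nat big1 => [|n /andP[_ ltn]].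
  rewrite [LHS]add0r /fps_scale iter_theta_monomial /fps_monomial eqxx mulr1.
  rewrite thetaE pochhammer1 /= -natrX -[f _ *+ _]mulr_natl.
  rewrite -mulrA -natrM mulrAC -natrM; congr (_%:R * _).
  by rewrite mulnCA mulnC -expnS.
by rewrite /fps_scale iter_theta_monomial /fps_monomial gtn_eqF // !mulr0.
Qed.

Lemma weight_gDfP l f g :
  fps_mul g (DM l f) =1 double_series (weight_gDf l) f g.
Proof.
move=> m; rewrite /double_series big_ord_recl !mul0r add0r /fps_mul.
rewrite (reindex_inj rev_ord_inj); apply: eq_bigr => i _ /=.
by rewrite DME subSS subKn -1?ltnS // mulrC.
Qed.

Lemma weight_fDgP l f g :
  fps_mul f (DM l g) =1 double_series (weight_fDg l) f g.
Proof.
move=> m; rewrite /double_series big_ord_recr /= /weight_fDg subnn !mul0r addr0.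
apply: eq_bigr => i _; rewrite DME subSn -1?ltnS // mulrA.
by congr (_ * _); rewrite mulrC.
Qed.

Definition gDf_expansion l f g : expansion f g (fps_mul g (DM l f)) :=
  Expansion (weight_gDfP l f g).

Definition fDg_expansion l f g : expansion f g (fps_mul f (DM l g)) :=
  Expansion (weight_fDgP l f g).

End Expansions.

(* Main.v *)
Require Import Defs.
From mathcomp Require Import all_boot all_order all_algebra.
From mathcomp Require Import reals.

(** By [DME], the coefficient of [x^m] on the left is [lnum l m.+1] times a Cauchy sum over pairs
    [n + k = m + 1]. This weight depends only on [n + k], so [hop] splits it as
    [op (lnum l n) (lnum l k)] in each term. *)

Theorem theorem2p1 (R : realType) (l : nat) (op : nat -> nat -> nat)
    (f g : fps R[i])
    (hop : forall n k : nat, op (lnum l n) (lnum l k) = lnum l (n + k)) :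
  DM l (fps_mul f g) =1 termwise op (fps_mul g (DM l f)) (fps_mul f (DM l g))
                                   (gDf_expansion l f g) (fDg_expansion l f g).
Proof.
move=> m; rewrite DME /fps_mul GRing.mulr_sumr.
apply: eq_bigr => i _ /=.
(* The bound [i < m.+2] makes the truncated subtraction exact: [i + (m.+1 - i) = m.+1]. *)
by rewrite /weight_gDf /weight_fDg hop subnKC -1?ltnS // GRing.mulrA.
Qed.
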